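(* For any distinct real numbers $p,q\in[1,\infty)$, the commutative Banach ring $\ell_p\oplus i\ell_q$ is not Hirsch.
   Context: For a real number $p\in[1,\infty)$, $\ell_p$ here denotes the real Banach space of functions $x:\omega\to\mathbb R$ with finite norm $\|x\|_{\ell_p}=\big(\sum_{k\in\omega}|x(k)|^p\big)^{1/p}$. $\mathbb C^\omega$ is the commutative ring of all complex-valued sequences with coordinatewise operations, and $\Re,\Im:\mathbb C\to\mathbb R$ are the functions of taking the real and imaginary parts. Given two real numbers $p,q\in[1,\infty)$, one considers the subring $\ell_p\oplus i\ell_q=\{z\in\mathbb C^\omega:\Re\circ z\in\ell_p,\ \Im\circ z\in\ell_q\}$ of the commutative ring $\mathbb C^\omega$; it is a Banach ring with respect to the norm $\|z\|=\max\{\|\Re\circ z\|_{\ell_p},\|\Im\circ z\|_{\ell_q}\}$. A topological ring is an Abelian topological group (written additively) endowed with a continuous associative binary multiplication that is distributive over addition on both sides. A Banach ring is a Banach space endowed with a binary operation turning it into a topological ring. A series $\sum_{n\in\omega}x_n$ in an Abelian topological group $G$ unconditionally converges to $x\in G$ if for any neighborhood $U$ of $0$ there is a finite set $F\subset\omega$ such that $\sum_{i\in J}x_i\in x+U$ for any finite set $J\subset\omega$ containing $F$; it is unconditionally convergent if it unconditionally converges to some $x\in G$. A topological ring $R$ is Hirsch if for any unconditionally convergent series $\sum_{n\in\omega}x_n$ in $R$ and any neighborhood $U\subseteq R$ of $0$ there exists a neighborhood $V\subseteq R$ of $0$ such that $\sum_{n\in F}a_nx_n\in U$ for any finite set $F\subset\omega$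 and any sequence $(a_n)_{n\in F}\in V^F$.
   Formalization: For q > 2p, ℓ_p ⊕ iℓ_q is not closed under the coordinatewise product, so it is not a ring; there the product is taken to be 0 whenever it leaves the space. For q ≤ 2p it is the true product, exactly as stated. *)

(* Defs.v *)
From HB Require Import structures.
From mathcomp Require Import all_boot all_order all_algebra finmap.
From mathcomp Require Import all_classical all_reals all_analysis.
From mathcomp Require Import complex.

Set Implicit Arguments.
Unset Strict Implicit.
Unset Printing Implicit Defensive.

Import Order.TTheory GRing.Theory Num.Theory.
Import numFieldNormedType.Exports.

Local Open Scope classical_set_scope.
Local Open Scope ring_scope.

Section topological_ring.
Context {G : topologicalZmodType}.
Implicit Types (x : nat -> G) (s : G) (mul : G -> G -> G).

(* Topological rings need not be unital (l_p (+) i l_q is not), so the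
   multiplication is a plain binary operation instead of a [pzRingType]. *)
Definition topological_ring mul : Prop :=
  [/\ continuous (fun z : G * G => mul z.1 z.2), associative mul,
      left_distributive mul +%R & right_distributive mul +%R].

Definition unconditionally_converges x s : Prop :=
  forall U : set G, nbhs 0 U -> exists F : {fset nat},
    forall J : {fset nat}, (F `<=` J)%fset ->
      [set s + u | u in U] (\sum_(i <- J) x i).

Definition unconditionally_convergent x : Prop :=
  exists s, unconditionally_converges x s.

Definition hirsch mul : Prop :=
  forall x, unconditionally_convergent x ->
  forall U : set G, nbhs 0 U -> exists2 V : set G, nbhs 0 V &
    forall (F : {fset nat}) (a : nat -> G), (forall n, n \in F -> V (a n)) ->
      U (\sum_(n <- F) mul (a n) (x n)).

End topological_ring.

Section lp.
Context {R : realType}.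
Implicit Types (p : R) (x y : R^nat).

Definition lp_norme p x : \bar R :=
  ((\sum_(0 <= k <oo) (`|x k| `^ p)%:E) `^ p^-1)%E.

Definition lp p : set R^nat := [set x | (lp_norme p x < +oo)%E].

Definition lp_norm p x : R := fine (lp_norme p x).

Lemma lp_normeE p x : 0 < p ->
  lp_norme p x = Lnorm (@counting nat R) p%:E (EFin \o x).
Proof. by move=> p0; rewrite Lnorm_counting. Qed.

Lemma lp_norme_ge0 p x : (0 <= lp_norme p x)%E.
Proof. exact: poweR_ge0. Qed.

Lemma lp_norm_ge0 p x : 0 <= lp_norm p x.
Proof. exact/fine_ge0/lp_norme_ge0. Qed.

Lemma lp_normEFin p x : x \in lp p -> (lp_norm p x)%:E = lp_norme p x.
Proof.
by rewrite inE => xp; rewrite fineK// ge0_fin_numE// lp_norme_ge0.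
Qed.

Lemma lp_norme_leP p x r : 0 < p -> 0 <= r ->
  (lp_norme p x <= r%:E)%E <->
  (forall n, \sum_(k < n) `|x k| `^ p <= r `^ p).
Proof.
move=> p0 r0.
have s0 : (0 <= \sum_(0 <= k <oo) (`|x k| `^ p)%:E)%E.
  by apply: nneseries_ge0 => *; rewrite lee_fin powR_ge0.
have -> : (lp_norme p x <= r%:E)%E =
    (\sum_(0 <= k <oo) (`|x k| `^ p)%:E <= (r `^ p)%:E)%E.
  rewrite /lp_norme -poweR_EFin; set S := limn _ in s0 *.
  have itv (z : \bar R) : (0 <= z)%E -> z \in `[0%E, +oo%E].
    by move=> z0; rewrite in_itv/= z0 leey.
  have r0' : (0 <= r%:E)%E by rewrite lee_fin.
  have mono (s : R) (u v : \bar R) : 0 <= s -> (0 <= u)%E -> (0 <= v)%E ->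
      (u <= v)%E -> (u `^ s <= v `^ s)%E.
    by move=> s_ge0 u0 v0; apply: gt0_ler_poweR => //; exact: itv.
  apply/idP/idP => h.
    have := mono p _ _ (ltW p0) (poweR_ge0 _ _) r0' h.
    by rewrite -poweRrM mulVf ?lt0r_neq0// poweRe1.
  have p'0 : 0 <= p^-1 by rewrite invr_ge0 ltW.
  have := mono p^-1 _ _ p'0 s0 (poweR_ge0 _ _) h.
  by rewrite -[in leRHS]poweRrM mulfV ?lt0r_neq0// [leRHS]poweRe1.
split => [h n|h].
  rewrite -lee_fin -sumEFin; apply: le_trans h.
  rewrite -(big_mkord xpredT (fun k => (`|x k| `^ p)%:E)).
  by apply: nneseries_lim_ge => *; rewrite lee_fin powR_ge0.
apply: lime_le; first by apply: is_cvg_nneseries => *; rewrite lee_fin powR_ge0.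
by apply: nearW => n; rewrite big_mkord sumEFin lee_fin.
Qed.

Lemma lp_norm_leP p x r : 0 < p -> 0 <= r ->
  (x \in lp p /\ lp_norm p x <= r) <->
  (forall n, \sum_(k < n) `|x k| `^ p <= r `^ p).
Proof.
move=> p0 r0; rewrite -lp_norme_leP//; split => [[xp]|h].
  by rewrite -lp_normEFin// lee_fin.
have xp : x \in lp p by rewrite inE /lp/= (le_lt_trans h) ?ltry.
by rewrite xp -lee_fin lp_normEFin.
Qed.

Lemma lp_normP p x n : 0 < p -> x \in lp p ->
  \sum_(k < n) `|x k| `^ p <= lp_norm p x `^ p.
Proof. by move=> p0 xp; move: n; apply/lp_norm_leP; rewrite ?lp_norm_ge0. Qed.

Lemma lp_coord_le p x k : 0 < p -> x \in lp p -> `|x k| <= lp_norm p x.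
Proof.
move=> p0 xp; rewrite leNgt; apply/negP => h.
have := lp_normP k.+1 p0 xp; apply/negP; rewrite -ltNge.
rewrite big_ord_recr/= ltr_wpDl//; first by apply: sumr_ge0 => *; exact: powR_ge0.
by rewrite gt0_ltr_powR// nnegrE// lp_norm_ge0.
Qed.

Lemma lp0 p : 0 < p -> (0 : R^nat) \in lp p /\ lp_norm p (0 : R^nat) <= 0.
Proof.
move=> p0; apply/lp_norm_leP => // n; rewrite big1 ?powR_ge0// => k _.
by rewrite normr0 powR0// gt_eqF.
Qed.

Lemma lp_norm0_eq0 p x : 0 < p -> x \in lp p -> lp_norm p x = 0 -> x = 0.
Proof.
move=> p0 xp x0; apply/funext => k; apply/eqP.
by rewrite -normr_le0 -x0 lp_coord_le.
Qed.

Lemma lpD p x y : 1 <= p -> x \in lp p -> y \in lp p ->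
  x + y \in lp p /\ lp_norm p (x + y) <= lp_norm p x + lp_norm p y.
Proof.
move=> p1 xp yp; have p0 := lt_le_trans ltr01 p1.
have : (lp_norme p (x + y)%R <= lp_norme p x + lp_norme p y)%E.
  by rewrite !lp_normeE//; apply: minkowski_EFin; rewrite ?lee_fin.
rewrite -(lp_normEFin xp) -(lp_normEFin yp) -EFinD => h.
have xyp : x + y \in lp p by rewrite inE /lp/= (le_lt_trans h) ?ltry.
by rewrite xyp -lee_fin lp_normEFin.
Qed.

Lemma lpZ p x a : 0 < p -> x \in lp p ->
  a *: x \in lp p /\ lp_norm p (a *: x) <= `|a| * lp_norm p x.
Proof.
move=> p0 xp; apply/lp_norm_leP => //; first by rewrite mulr_ge0// lp_norm_ge0.
move=> n; rewrite powRM// ?lp_norm_ge0//.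
under eq_bigr do rewrite normrM powRM//.
by rewrite -mulr_sumr ler_wpM2l ?powR_ge0// lp_normP.
Qed.

Lemma lpB p x y : 1 <= p -> x \in lp p -> y \in lp p ->
  x - y \in lp p /\ lp_norm p (x - y) <= lp_norm p x + lp_norm p y.
Proof.
move=> p1 xp yp; have p0 := lt_le_trans ltr01 p1.
have [yp' yp'2] := lpZ (- 1) p0 yp.
rewrite normrN normr1 mul1r in yp'2; rewrite -scaleN1r.
have [? h] := lpD p1 xp yp'; split=> //; apply: le_trans h _.
by rewrite lerD2l.
Qed.

Lemma lp_normZ p x a : 0 < p -> x \in lp p ->
  lp_norm p (a *: x) = `|a| * lp_norm p x.
Proof.
move=> p0 xp; apply/eqP; rewrite eq_le (lpZ a p0 xp).2/=.
have [->|a0] := eqVneq a 0; first by rewrite normr0 mul0r lp_norm_ge0.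
have [h1 h2] := lpZ a p0 xp; have [_] := lpZ a^-1 p0 h1.
by rewrite scalerA mulVf// scale1r normfV ler_pdivlMl ?normr_gt0.
Qed.


Lemma lp_mul_bounded p x y M : 0 < p -> 0 <= M ->
  (forall k, `|x k| <= M) -> y \in lp p ->
  x * y \in lp p /\ lp_norm p (x * y) <= M * lp_norm p y.
Proof.
move=> p0 M0 xM yp; apply/lp_norm_leP => //; first by rewrite mulr_ge0 ?lp_norm_ge0.
move=> n; rewrite powRM ?lp_norm_ge0//.
apply: (@le_trans _ _ (M `^ p * \sum_(k < n) `|y k| `^ p)); last first.
  by rewrite ler_wpM2l ?powR_ge0 ?lp_normP.
rewrite mulr_sumr; apply: ler_sum => k _.
rewrite normrM powRM// ler_wpM2r ?powR_ge0//.
by apply: ge0_ler_powR; rewrite ?nnegrE ?(ltW p0).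
Qed.

Lemma lp_mul_unit p q x y : 0 < p -> 0 < q -> q <= 2 * p ->
  x \in lp q -> y \in lp q -> lp_norm q x <= 1 -> lp_norm q y <= 1 ->
  x * y \in lp p /\ lp_norm p (x * y) <= 1.
Proof.
move=> p0 q0 qp xq yq x1 y1; apply/lp_norm_leP => // n.
have le1 z k : z \in lp q -> lp_norm q z <= 1 -> (`|z k| `^ p) ^+ 2 <= `|z k| `^ q.
  move=> zq z1; rewrite -powR_mulrn ?powR_ge0// -powRrM.
  have [->|z0] := eqVneq (z k) 0.
    by rewrite normr0 !powR0 ?gt_eqF ?mulr_gt0.
  apply: ger_powR; last by rewrite mulrC.
  by rewrite normr_gt0 z0/= (le_trans _ z1)// lp_coord_le.
have sum1 z : z \in lp q -> lp_norm q z <= 1 -> \sum_(k < n) `|z k| `^ q <= 1.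
  by move=> zq z1; have /(lp_norm_leP _ q0 ler01)/(_ n) := conj zq z1; rewrite powR1.
rewrite powR1.
apply: (@le_trans _ _ ((\sum_(k < n) `|x k| `^ q + \sum_(k < n) `|y k| `^ q) / 2)).
  rewrite -big_split/= mulr_suml; apply: ler_sum => k _.
  rewrite normrM powRM// ler_pdivlMr//.
  apply: le_trans (lerD (le1 _ k xq x1) (le1 _ k yq y1)).
  by rewrite mulr_natr -subr_ge0 addrAC -sqrrB sqr_ge0.
by rewrite ler_pdivrMr// mul1r -[2]/(1 + 1) lerD// sum1.
Qed.

Lemma lp_mul p q x y : 0 < p -> 0 < q -> q <= 2 * p ->
  x \in lp q -> y \in lp q ->
  x * y \in lp p /\ lp_norm p (x * y) <= lp_norm q x * lp_norm q y.
Proof.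
move=> p0 q0 qp xq yq.
have [X0|X0] := eqVneq (lp_norm q x) 0.
  rewrite X0 (lp_norm0_eq0 q0 xq X0) !mul0r; exact: lp0.
have [Y0|Y0] := eqVneq (lp_norm q y) 0.
  rewrite Y0 (lp_norm0_eq0 q0 yq Y0) !mulr0; exact: lp0.
set a := lp_norm q x in X0 *; set b := lp_norm q y in Y0 *.
have n1 z : z \in lp q -> lp_norm q z != 0 ->
    lp_norm q ((lp_norm q z)^-1 *: z) <= 1.
  by move=> zq z0; rewrite lp_normZ// ger0_norm ?invr_ge0 ?lp_norm_ge0// mulVf.
have [h1 h2] := lp_mul_unit p0 q0 qp (lpZ a^-1 q0 xq).1 (lpZ b^-1 q0 yq).1
  (n1 _ xq X0) (n1 _ yq Y0).
have -> : x * y = (a * b) *: ((a^-1 *: x) * (b^-1 *: y)).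
  apply/funext => k; rewrite -[LHS]/(x k * y k).
  rewrite -[RHS]/((a * b) * ((a^-1 * x k) * (b^-1 * y k))).
  by rewrite (mulrACA a^-1) (mulrA (a * b)) (mulrACA a) !mulfV// !mul1r.
have [-> h3] := lpZ (a * b) p0 h1; split=> //; rewrite (le_trans h3)//.
have ab0 : 0 <= a * b by rewrite mulr_ge0 ?lp_norm_ge0.
by rewrite ger0_norm// ler_piMr.
Qed.

Lemma powR_norm_continuous p : 0 < p -> continuous (fun t : R => `|t| `^ p).
Proof.
move=> p0 x; have [->|x0] := eqVneq x 0.
  apply/cvgrPdist_le => e e0; near=> t.
  rewrite normr0 powR0 ?gt_eqF// sub0r normrN ger0_norm ?powR_ge0//.
  have -> : e = (e `^ p^-1) `^ p.
    by rewrite -powRrM mulVf ?lt0r_neq0// powRr1// ltW.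
  apply: ge0_ler_powR; rewrite ?nnegrE ?powR_ge0// ?(ltW p0)//.
  near: t; exact: (nbhs0_le (V := R^o) (powR_gt0 _ e0)).
apply: (@continuous_comp R^o R^o R^o (fun t => `|t|) (fun t => t `^ p)).
  exact: norm_continuous.
apply: differentiable_continuous; apply/derivable1_diffP.
by apply: derivable_powR; rewrite in_itv/= andbT normr_gt0.
Unshelve. all: by end_near. Qed.

Lemma lp_norm_lim p (T : Type) (F : set_system T) (FF : ProperFilter F)
    (f : T -> R^nat) (a : R^nat) r : 0 < p -> 0 <= r ->
  (forall k, f t k @[t --> F] --> a k) ->
  (\forall t \near F, f t \in lp p /\ lp_norm p (f t) <= r) ->
  a \in lp p /\ lp_norm p a <= r.
Proof.
move=> p0 r0 fa fr; apply/lp_norm_leP => // n.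
apply: (@closed_cvg _ _ F _ (fun t => \sum_(k < n) `|f t k| `^ p)
  (fun s => s <= r `^ p)).
- exact: closed_le.
- by apply: filterS fr => t /(lp_norm_leP _ p0 r0)/(_ n).
- apply: cvg_big => [|k _]; first exact: add_continuous.
  exact: (continuous_cvg _ (@powR_norm_continuous p p0 _) (fa k)).
Qed.

End lp.

(* [Rcomplex R] is [R[i]] with its structure of real vector space, and
   [nat -> Rcomplex R] is the ring of all complex sequences, with coordinatewise
   operations. *)
Definition lpilq_pred {R : realType} (p q : R) : {pred nat -> Rcomplex R} :=
  fun z => (@complex.Re R \o z \in lp p) && (@complex.Im R \o z \in lp q).

Record lpilq {R : realType} (p q : R) (p1 : 1 <= p) (q1 : 1 <= q) := Lpilq {
  lpilq_val :> nat -> Rcomplex R;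
  lpilq_valP : lpilq_val \in lpilq_pred p q }.

HB.instance Definition _ {R : realType} (p q : R) (p1 : 1 <= p) (q1 : 1 <= q) :=
  [isSub for @lpilq_val R p q p1 q1].
HB.instance Definition _ {R : realType} (p q : R) (p1 : 1 <= p) (q1 : 1 <= q) :=
  [Choice of lpilq p1 q1 by <:].

Section lpilq_normed.
Context {R : realType} (p q : R) (p1 : 1 <= p) (q1 : 1 <= q).
Local Notation V := (lpilq p1 q1).
Local Notation Re z := (@complex.Re R \o z).
Local Notation Im z := (@complex.Im R \o z).
Implicit Types (z w : nat -> Rcomplex R).

Let p0 : 0 < p. Proof. exact: lt_le_trans p1. Qed.
Let q0 : 0 < q. Proof. exact: lt_le_trans q1. Qed.

Lemma ReD z w : Re (z + w) = Re z + Re w.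
Proof. by apply/funext => k; exact: raddfD. Qed.

Lemma ImD z w : Im (z + w) = Im z + Im w.
Proof. by apply/funext => k; exact: raddfD. Qed.

Lemma ReB z w : Re (z - w) = Re z - Re w.
Proof. by apply/funext => k; exact: raddfB. Qed.

Lemma ImB z w : Im (z - w) = Im z - Im w.
Proof. by apply/funext => k; exact: raddfB. Qed.

Lemma ReZ a z : Re (a *: z) = a *: Re z.
Proof. by apply/funext => k; exact: linearZ. Qed.

Lemma ImZ a z : Im (a *: z) = a *: Im z.
Proof. by apply/funext => k; exact: linearZ. Qed.

Lemma ReM z w : Re (z * w) = Re z * Re w - Im z * Im w.
Proof.
apply/funext => k.
rewrite -[RHS]/(complex.Re (z k) * complex.Re (w k)
  - complex.Im (z k) * complex.Im (w k)) -[LHS]/(complex.Re (z k * w k)).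
by case: (z k) => a b; case: (w k).
Qed.

Lemma ImM z w : Im (z * w) = Re z * Im w + Im z * Re w.
Proof.
apply/funext => k.
rewrite -[RHS]/(complex.Re (z k) * complex.Im (w k)
  + complex.Im (z k) * complex.Re (w k)) -[LHS]/(complex.Im (z k * w k)).
by case: (z k) => a b; case: (w k).
Qed.

Lemma lpilq_predP z :
  reflect (Re z \in lp p /\ Im z \in lp q) (z \in lpilq_pred p q).
Proof. exact: andP. Qed.

Lemma lpilq_submod_closed : subsemimod_closed (lpilq_pred p q).
Proof.
split; first split.
- by apply/lpilq_predP; split; [exact: (lp0 p0).1|exact: (lp0 q0).1].
- move=> x y /lpilq_predP[? ?] /lpilq_predP[? ?]; apply/lpilq_predP.
  by rewrite ReD ImD; split; [apply: (lpD p1 _ _).1|apply: (lpD q1 _ _).1].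
- move=> a x /lpilq_predP[? ?]; apply/lpilq_predP.
  by rewrite ReZ ImZ; split; [apply: (lpZ _ p0 _).1|apply: (lpZ _ q0 _).1].
Qed.

HB.instance Definition _ :=
  GRing.SubChoice_isSubLmodule.Build R (nat -> Rcomplex R) (lpilq_pred p q) V
    lpilq_submod_closed.

Lemma lpilq_Re (x : V) : Re x \in lp p.
Proof. by have /lpilq_predP[] := lpilq_valP x. Qed.

Lemma lpilq_Im (x : V) : Im x \in lp q.
Proof. by have /lpilq_predP[] := lpilq_valP x. Qed.

Definition lpilq_norm (x : V) : R :=
  Num.max (lp_norm p (Re x)) (lp_norm q (Im x)).

Lemma lpilq_norm_ge0 (x : V) : 0 <= lpilq_norm x.
Proof. by rewrite le_max lp_norm_ge0. Qed.

Lemma lpilq_norm_leP (x : V) r :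
  reflect (lp_norm p (Re x) <= r /\ lp_norm q (Im x) <= r) (lpilq_norm x <= r).
Proof. by rewrite ge_max; exact: andP. Qed.

Lemma lpilq_norm_Re (x : V) : lp_norm p (Re x) <= lpilq_norm x.
Proof. by rewrite le_max lexx. Qed.

Lemma lpilq_norm_Im (x : V) : lp_norm q (Im x) <= lpilq_norm x.
Proof. by rewrite le_max lexx orbT. Qed.

Lemma lpilq_ler_normD (x y : V) :
  lpilq_norm (x + y) <= lpilq_norm x + lpilq_norm y.
Proof.
apply/lpilq_norm_leP; rewrite ReD ImD; split.
  apply: le_trans (lpD p1 (lpilq_Re x) (lpilq_Re y)).2 _.
  by rewrite lerD// lpilq_norm_Re.
apply: le_trans (lpD q1 (lpilq_Im x) (lpilq_Im y)).2 _.
by rewrite lerD// lpilq_norm_Im.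
Qed.

Lemma lpilq_normrZ (l : R) (x : V) : lpilq_norm (l *: x) = `|l| * lpilq_norm x.
Proof.
rewrite /lpilq_norm ReZ ImZ.
by rewrite (lp_normZ _ p0 (lpilq_Re x)) (lp_normZ _ q0 (lpilq_Im x)) maxr_pMr.
Qed.

Lemma lpilq_normr0_eq0 (x : V) : lpilq_norm x = 0 -> x = 0.
Proof.
move=> x0; apply/val_inj/funext => k; apply/eqP; rewrite eq_complex.
have := lp_coord_le k p0 (lpilq_Re x); have := lp_coord_le k q0 (lpilq_Im x).
move=> /le_trans/(_ (lpilq_norm_Im x)) + /le_trans/(_ (lpilq_norm_Re x)).
by rewrite x0 !normr_le0 => /eqP/= -> /eqP/= ->; rewrite !eqxx.
Qed.

HB.instance Definition _ := Lmodule_isNormed.Build R V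
  lpilq_ler_normD lpilq_normrZ lpilq_normr0_eq0.

Lemma lpilq_complete (F : set_system V) : ProperFilter F -> cauchy F -> cvg F.
Proof.
move=> FF /cauchy_ballP Fc.
have Fnear e : 0 < e -> \forall x \near F & y \near F, `|x - y| <= e.
  move=> e0; have := Fc e e0; apply: filterS => -[x y].
  by rewrite -ball_normE/= => /ltW.
have coord (f : nat -> V -> R) :
    (forall k x y, `|f k x - f k y| <= `|x - y|) ->
    forall k, cvg (f k @ F).
  move=> fle k; apply: R_complete; apply/cauchy_ballP => e e0.
  have e20 : 0 < e / 2 by rewrite divr_gt0.
  have := Fnear _ e20 => -[[A B]/= [FA FB] AB].
  exists (f k @` A, f k @` B).
    by split; rewrite /fmap/=; [apply: filterS FA|apply: filterS FB] => t ?; exists t.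
  move=> [_ _] [/= [x Ax <-] [y By <-]]; rewrite -ball_normE/=.
  apply: le_lt_trans (fle _ _ _) _; apply: le_lt_trans (AB (x, y) (conj Ax By)) _.
  by rewrite ltr_pdivrMr// ltr_pMr// ltr1n.
have cRe : forall k, cvg ((fun x : V => Re x k) @ F).
  apply: (coord (fun k x => Re x k)) => k x y.
  have := lp_coord_le k p0 (lpilq_Re (x - y)).
  rewrite ReB => /le_trans; apply; rewrite -ReB.
  exact: (lpilq_norm_Re (x - y)).
have cIm : forall k, cvg ((fun x : V => Im x k) @ F).
  apply: (coord (fun k x => Im x k)) => k x y.
  have := lp_coord_le k q0 (lpilq_Im (x - y)).
  rewrite ImB => /le_trans; apply; rewrite -ImB.
  exact: (lpilq_norm_Im (x - y)).
pose a k := lim ((fun x : V => Re x k) @ F).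
pose b k := lim ((fun x : V => Im x k) @ F).
pose l : nat -> Rcomplex R := fun k => Complex (a k) (b k).
have key e : 0 < e -> F [set x : V |
    [/\ Re x - Re l \in lp p, Im x - Im l \in lp q,
      lp_norm p (Re x - Re l) <= e & lp_norm q (Im x - Im l) <= e]].
  move=> e0; have := Fnear _ e0 => -[[A B]/= [FA FB] AB].
  apply: filterS FA => x Ax.
  have [] : Re x - Re l \in lp p /\ lp_norm p (Re x - Re l) <= e.
    apply: (@lp_norm_lim _ p V F FF (fun y => Re x - Re y)) => //; first exact: ltW.
      by move=> k; apply: cvgB; [exact: cvg_cst|exact: cRe].
    apply: filterS FB => y By; rewrite -ReB; split; first exact: (lpilq_Re (x - y)).
    exact: le_trans (lpilq_norm_Re (x - y)) (AB (x, y) (conj Ax By)).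
  have [] : Im x - Im l \in lp q /\ lp_norm q (Im x - Im l) <= e.
    apply: (@lp_norm_lim _ q V F FF (fun y => Im x - Im y)) => //; first exact: ltW.
      by move=> k; apply: cvgB; [exact: cvg_cst|exact: cIm].
    apply: filterS FB => y By; rewrite -ImB; split; first exact: (lpilq_Im (x - y)).
    exact: le_trans (lpilq_norm_Im (x - y)) (AB (x, y) (conj Ax By)).
  by [].
have lV : l \in lpilq_pred p q.
  have [x [xa xb _ _]] := filter_ex (key 1 ltr01).
  apply/lpilq_predP; split.
    have -> : Re l = Re x + -1 *: (Re x - Re l) by rewrite scaleN1r opprB addrC subrK.
    by apply: (lpD p1 (lpilq_Re x) _).1; exact: (lpZ _ p0 xa).1.
  have -> : Im l = Im x + -1 *: (Im x - Im l) by rewrite scaleN1r opprB addrC subrK.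
  by apply: (lpD q1 (lpilq_Im x) _).1; exact: (lpZ _ q0 xb).1.
apply/cvg_ex; exists (Lpilq p1 q1 lV); apply/cvgrPdist_le => e e0.
apply: filterS (key e e0) => x [_ _ xa xb]; rewrite distrC.
by apply/lpilq_norm_leP; rewrite ReB ImB.
Qed.

HB.instance Definition _ := Uniform_isComplete.Build V lpilq_complete.

(* The restriction of the multiplication of [nat -> Rcomplex R]. The set
   l_p (+) i l_q is closed under it iff q <= 2 p: for q > 2 p the product of two
   purely imaginary sequences can fail to be in l_p. A product that falls outside
   the set is set to 0, which makes the operation total for all p and q; see
   [val_lpilq_mul] and [lpilq_banach_ring] for q <= 2 p. *)
Definition lpilq_mul (x y : V) : V := insubd 0 (\val x * \val y).

Lemma lpilq_mul_bound (x y : V) : q <= 2 * p ->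
  [/\ \val x * \val y \in lpilq_pred p q,
    lp_norm p (Re (\val x * \val y)) <= 2 * `|x| * `|y| &
    lp_norm q (Im (\val x * \val y)) <= 2 * `|x| * `|y|].
Proof.
move=> qp.
have Mle (a b : R) : 0 <= a -> 0 <= b -> a <= `|x| -> b <= `|y| ->
  a * b <= `|x| * `|y| by move=> *; exact: ler_pM.
have Mle' (a b : R) : 0 <= a -> 0 <= b -> a <= `|y| -> b <= `|x| ->
  a * b <= `|x| * `|y| by move=> *; rewrite mulrC; exact: Mle.
have tri (a b c : R) : c <= a + b -> a <= `|x| * `|y| -> b <= `|x| * `|y| ->
    c <= 2 * `|x| * `|y|.
  move=> cab aM bM; apply: le_trans cab _.
  by rewrite -mulrA -[2]/(1 + 1) mulrDl mul1r lerD.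
have [rr1 rr2] := lp_mul_bounded p0 (lp_norm_ge0 p (Re x))
  (fun k => lp_coord_le k p0 (lpilq_Re x)) (lpilq_Re y).
have [ii1 ii2] := lp_mul p0 q0 qp (lpilq_Im x) (lpilq_Im y).
have [ri1 ri2] := lp_mul_bounded q0 (lp_norm_ge0 p (Re x))
  (fun k => lp_coord_le k p0 (lpilq_Re x)) (lpilq_Im y).
have [ir1 ir2] := lp_mul_bounded q0 (lp_norm_ge0 p (Re y))
  (fun k => lp_coord_le k p0 (lpilq_Re y)) (lpilq_Im x).
have [A1 A2] := lpB p1 rr1 ii1; have [B1 B2] := lpD q1 ri1 ir1.
have ReE : Re (\val x * \val y) = Re x * Re y - Im x * Im y by exact: ReM.
have ImE : Im (\val x * \val y) = Re x * Im y + Re y * Im x.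
  by rewrite ImM [Re y * _]mulrC.
split; first by apply/lpilq_predP; rewrite ReE ImE.
- rewrite ReE; apply: tri A2 _ _; [apply: le_trans rr2 _|apply: le_trans ii2 _].
    by apply: Mle; rewrite ?lp_norm_ge0//; exact: lpilq_norm_Re.
  by apply: Mle; rewrite ?lp_norm_ge0//; exact: lpilq_norm_Im.
- rewrite ImE; apply: tri B2 _ _; [apply: le_trans ri2 _|apply: le_trans ir2 _].
    apply: Mle; rewrite ?lp_norm_ge0//; first exact: lpilq_norm_Re.
    exact: lpilq_norm_Im.
  apply: Mle'; rewrite ?lp_norm_ge0//; first exact: lpilq_norm_Re.
  exact: lpilq_norm_Im.
Qed.

Lemma val_lpilq_mul (x y : V) : q <= 2 * p ->
  \val (lpilq_mul x y) = \val x * \val y.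
Proof. by move=> qp; rewrite insubdK//; have [] := lpilq_mul_bound x y qp. Qed.

Lemma lpilq_normM (x y : V) : q <= 2 * p -> `|lpilq_mul x y| <= 2 * `|x| * `|y|.
Proof.
move=> qp; have [_ h1 h2] := lpilq_mul_bound x y qp; apply/lpilq_norm_leP.
by rewrite -[lpilq_val _]/(\val (lpilq_mul x y)) val_lpilq_mul.
Qed.

Lemma lpilq_banach_ring : q <= 2 * p ->
  topological_ring lpilq_mul /\ commutative lpilq_mul.
Proof.
move=> qp; have vM x y : \val (lpilq_mul x y) = \val x * \val y.
  exact: val_lpilq_mul.
have mulA : associative lpilq_mul.
  by move=> x y z; apply/val_inj; rewrite !vM mulrA.
have mulDl : left_distributive lpilq_mul +%R.
  by move=> x y z; apply/val_inj; rewrite raddfD/= !vM raddfD mulrDl.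
have mulDr : right_distributive lpilq_mul +%R.
  by move=> x y z; apply/val_inj; rewrite raddfD/= !vM raddfD mulrDr.
have mulC : commutative lpilq_mul.
  by move=> x y; apply/val_inj; rewrite !vM mulrC.
split=> //; split=> // -[x y].
have E (u v : V) : lpilq_mul x y - lpilq_mul u v =
    lpilq_mul x (y - v) + lpilq_mul (x - u) v.
  by apply/val_inj; rewrite raddfB raddfD/= !vM !raddfB mulrBr mulrBl addrA subrK.
have lim0 : 2 * `|x| * `|y - z.2| + 2 * `|x - z.1| * `|z.2|
    @[z --> (x, y)] --> (0 : R).
  have l1 : z.1 @[z --> (x, y)] --> x by exact: cvg_fst.
  have l2 : z.2 @[z --> (x, y)] --> y by exact: cvg_snd.
  have d1 : `|x - z.1| @[z --> (x, y)] --> (`|x - x| : R).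
    by apply: cvg_norm; apply: cvgB => //; exact: cvg_cst.
  have d2 : `|y - z.2| @[z --> (x, y)] --> (`|y - y| : R).
    by apply: cvg_norm; apply: cvgB => //; exact: cvg_cst.
  rewrite !subrr normr0 in d1 d2.
  have -> : 0 = 2 * `|x| * 0 + 2 * 0 * `|y| :> R by rewrite !mulr0 mul0r addr0.
  apply: cvgD; first by apply: cvgM => //; exact: cvg_cst.
  by apply: cvgM; [apply: cvgM => //; exact: cvg_cst|exact: cvg_norm].
apply/cvgrPdist_le => e e0.
move/cvgrPdist_le : lim0 => /(_ e e0); apply: filterS => -[u v]/=.
rewrite sub0r normrN => huv.
rewrite E; apply: le_trans (ler_normD _ _) _; apply: le_trans huv.
by rewrite ger0_norm ?addr_ge0 ?mulr_ge0// lerD ?lpilq_normM.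
Qed.

End lpilq_normed.

Arguments lpilq_norm {R p q} p1 q1 x.
Arguments lpilq_mul {R p q} p1 q1 x y.

(* Main.v *)
(* Every z in l_p (+) i l_q is the unconditional sum of its coordinates z_n e_n.
   If the ring is Hirsch, multiplying this series termwise by d i e_n with d > 0
   small gives uniformly bounded finite sums d i z_n e_n, so i z lies in
   l_p (+) i l_q as well. Hence l_p = l_q, which the sequence (n+1)^(-1/p) refutes
   for p < q (and symmetrically for q < p). *)
Require Import Defs.
From mathcomp Require Import all_boot all_order all_algebra.
From mathcomp Require Import all_classical all_reals all_analysis.
From mathcomp Require Import finmap complex lra.

Set Implicit Arguments.
Unset Strict Implicit.
Unset Printing Implicit Defensive.

Import Order.TTheory GRing.Theory Num.Theory.
Import numFieldNormedType.Exports.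

Local Open Scope ring_scope.

(** * Sequences in l_q outside l_p for p < q, and uniform tail estimates in l_p *)

Section lp_facts.
Context {R : realType}.
Implicit Types (p q : R) (x y : R^nat).

(** Cauchy condensation: the denominators from 2^m to 2^(m+1) - 1 give 2^m terms, each at most
    (2^m)^(-t), so this block contributes at most [r ^+ m] with [r] = 2^(1-t) < 1. *)
Lemma riemannR_sum_bounded (t : R) : 1 < t ->
  exists M, forall n, \sum_(k < n) riemannR t k <= M.
Proof.
move=> t1; have t0 : 0 < t by lra.
pose r : R := 2 `^ (1 - t).
have r0 : 0 < r by rewrite powR_gt0.
have r1 : r < 1.
  have E1 : 1 `^ (t - 1) = 1 :> R by rewrite powR1.
  rewrite /r -opprB powRN invf_lt1 ?powR_gt0// -[ltLHS]E1.
  by rewrite gt0_ltr_powR ?nnegrE ?ltr1n// subr_gt0.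
have rt_ge0 k : 0 <= riemannR t k by apply/ltW/riemannR_gt0/ltW.
have block m : \sum_(k < (2 ^ m).-1) riemannR t k <= \sum_(j < m) r ^+ j.
  elim: m => [|m IHm]; first by rewrite !big_ord0.
  rewrite big_ord_recr/=; apply: le_trans (lerD IHm (lexx _)).
  (* Indices start at 0 while [riemannR t k] is (k+1)^(-t), so the denominators below 2^m are the
     first 2^m - 1 terms. *)
  have E : ((2 ^ m.+1).-1 = (2 ^ m).-1 + 2 ^ m)%N.
    by rewrite expnS mul2n -addnn -!subn1 addnBAC// expn_gt0.
  rewrite E big_split_ord/= lerD2l.
  apply: (@le_trans _ _ (\sum_(i < 2 ^ m) ((2 ^ m)%:R `^ t)^-1)).
    apply: ler_sum => i _; rewrite lef_pV2 ?posrE ?powR_gt0 ?ltr0n ?expn_gt0//.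
    apply: ge0_ler_powR; rewrite ?nnegrE ?ler0n ?(ltW t0)// ler_nat.
    by rewrite -addSn prednK ?expn_gt0// leq_addr.
  rewrite sumr_const card_ord -[leLHS]mulr_natl natrX -[2 ^+ m]powR_mulrn//.
  rewrite -powRN -!powRrM -powRD; last by rewrite pnatr_eq0 implybT.
  by rewrite -powR_mulrn ?(ltW r0)// /r -powRrM mulrBl mul1r mulrN [m%:R * t]mulrC.
(* Since n <= 2^n - 1, the first n terms are covered by n dyadic blocks, and the geometric sum is at
   most 1/(1-r). *)
exists (1 - r)^-1 => n.
apply: (@le_trans _ _ (\sum_(k < (2 ^ n).-1) riemannR t k)).
  have nn : (n <= (2 ^ n).-1)%N by rewrite -ltnS prednK ?expn_gt0// ltn_expl.
  rewrite -!(big_mkord xpredT (riemannR t)) (big_cat_nat (leq0n n) nn)//=.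
  by rewrite lerDl sumr_ge0.
apply: le_trans (block n) _.
rewrite -[leRHS]mul1r ler_pdivlMr ?subr_gt0// mulrC -[leLHS]opprK -mulNr opprB.
by rewrite -subrX1 opprB gerBl exprn_ge0 ?(ltW r0).
Qed.

Lemma lp_not_sub p q : 1 <= p -> p < q -> exists x, x \in lp q /\ x \notin lp p.
Proof.
move=> p1 pq; have p0 : 0 < p by lra. have q0 : 0 < q by lra.
(* The p-th powers of [x] form the harmonic series, its q-th powers the Riemann series of exponent
   q/p > 1. *)
pose x : R^nat := riemannR p^-1.
have x0 k : 0 < x k by rewrite riemannR_gt0// invr_ge0 ltW.
have xE s k : `|x k| `^ s = riemannR (p^-1 * s) k.
  by rewrite (gtr0_norm (x0 k)) /x /riemannR -powRN -powRrM mulNr powRN.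
exists x; split.
  have [|M hM] := @riemannR_sum_bounded (p^-1 * q).
    by rewrite mulrC ltr_pdivlMr ?mul1r.
  have M0 : 0 <= M by have := hM 0%N; rewrite big_ord0.
  suff : x \in lp q /\ lp_norm q x <= M `^ q^-1 by case.
  apply/lp_norm_leP; rewrite ?powR_ge0// => n.
  rewrite -powRrM mulVf ?gt_eqF// powRr1//.
  by under eq_bigr do rewrite xE.
apply/negP => xp; apply: (@dvg_harmonic R).
have hE k : `|x k| `^ p = harmonic k.
  by rewrite xE mulVf ?gt_eqF// /riemannR powRr1.
apply: nondecreasing_is_cvgn.
  by apply/nondecreasing_series => k _ _; exact: harmonic_ge0.
exists (lp_norm p x `^ p) => _ [n _ <-]; rewrite /series/= big_mkord.
by have := lp_normP n p0 xp; under eq_bigr do rewrite hE.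
Qed.

(** This is the Cauchy criterion for the series of |x k|^p with threshold e^p. A single [N] serves
    all dominated [y], so it can be chosen before the finite set whose complement supports [y]. *)
Lemma lp_tail p x e : 0 < p -> x \in lp p -> 0 < e ->
  exists N, forall y, (forall k, (k < N)%N -> y k = 0) ->
    (forall k, `|y k| <= `|x k|) -> lp_norm p y <= e.
Proof.
move=> p0 xp e0.
pose u k := `|x k| `^ p.
have u0 k : 0 <= u k by exact: powR_ge0.
have cu : cvgn (series u).
  apply: nondecreasing_is_cvgn; first exact/nondecreasing_series.
  exists (lp_norm p x `^ p) => _ [n _ <-]; rewrite /series/= big_mkord.
  exact: lp_normP.
have /cauchy_cvgP/cauchy_seriesP/(_ _ (powR_gt0 p e0)) := cu.
case=> -[A B] [/= [N1 _ hA] [N2 _ hB]] hAB.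
exists (maxn N1 N2) => y y0 yx.
suff : y \in lp p /\ lp_norm p y <= e by case.
apply/lp_norm_leP; rewrite ?(ltW e0)// => n.
set N := maxn N1 N2 in y0 *.
have [nN|Nn] := leqP n N.
  rewrite big1 ?powR_ge0// => k _.
  by rewrite y0 ?normr0 ?powR0 ?gt_eqF// (leq_trans (ltn_ord k)).
have /= := hAB (N, n); rewrite ger0_norm ?sumr_ge0// => /(_ _)/ltW h.
(* The part below [N] vanishes; the rest is dominated termwise by the Cauchy block of [x] from [N]
   to [n]. *)
rewrite -(big_mkord xpredT (fun k => `|y k| `^ p)) (big_cat_nat (leq0n N) (ltnW Nn))//=.
rewrite big_nat big1 ?add0r => [|k /andP[_ kN]]; last first.
  by rewrite y0// normr0 powR0 ?gt_eqF.
apply: le_trans (h _); last first.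
  split; first by apply: hA; exact: leq_maxl.
  by apply: hB; rewrite /= (leq_trans _ (ltnW Nn))// leq_maxr.
by apply: ler_sum => k _; apply: ge0_ler_powR; rewrite ?nnegrE ?(ltW p0).
Qed.

Lemma lp_single p n (a : R) : 0 < p ->
  (fun k => if k == n then a else 0) \in lp p /\
  lp_norm p (fun k => if k == n then a else 0) <= `|a|.
Proof.
move=> p0; apply/lp_norm_leP => // m.
rewrite (eq_bigr (fun k : 'I_m => if k == n :> nat then `|a| `^ p else 0)).
  rewrite -big_mkcond/= (big_ord1_eq _ (fun=> _)).
  by case: ifP => // _; exact: powR_ge0.
by move=> k _; case: eqP => // _; rewrite normr0 powR0 ?gt_eqF.
Qed.

End lp_facts.

(** * Coordinate expansions in l_p (+) i l_q and multiplication by i *)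

Section lpilq_facts.
Context {R : realType} (p q : R) (p1 : 1 <= p) (q1 : 1 <= q).
Local Notation V := (lpilq p1 q1).
Local Notation Re z := (@complex.Re R \o z).
Local Notation Im z := (@complex.Im R \o z).
Implicit Types (w : Rcomplex R) (J : {fset nat}).

Let p0 : 0 < p. Proof. exact: lt_le_trans p1. Qed.
Let q0 : 0 < q. Proof. exact: lt_le_trans q1. Qed.

Let single_fun n w : nat -> Rcomplex R := fun k => if k == n then w else 0.

Let Re_single n w :
  Re (single_fun n w) = fun k => if k == n then complex.Re w else 0.
Proof. by apply/funext => k; rewrite /single_fun/=; case: eqP. Qed.

Let Im_single n w :
  Im (single_fun n w) = fun k => if k == n then complex.Im w else 0.
Proof. by apply/funext => k; rewrite /single_fun/=; case: eqP. Qed.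

Lemma single_subproof n w : single_fun n w \in lpilq_pred p q.
Proof.
apply/lpilq_predP; rewrite Re_single Im_single.
by split; [exact: (lp_single n _ p0).1|exact: (lp_single n _ q0).1].
Qed.

Definition single n w : V := Lpilq p1 q1 (single_subproof n w).

Lemma norm_single n w r : `|complex.Re w| <= r -> `|complex.Im w| <= r ->
  `|single n w| <= r.
Proof.
move=> rer imr; apply/lpilq_norm_leP; rewrite /= Re_single Im_single; split.
  exact: le_trans (lp_single n _ p0).2 rer.
exact: le_trans (lp_single n _ q0).2 imr.
Qed.

(* The product stays in l_p (+) i l_q even if q > 2 p. *)
Lemma mul_single n w w' :
  lpilq_mul p1 q1 (single n w) (single n w') = single n (w * w').
Proof.
have E : \val (single n w) * \val (single n w') = single_fun n (w * w').
  apply/funext => k; rewrite /= -[LHS]/(single_fun n w k * single_fun n w' k).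
  by rewrite /single_fun; case: eqP => // _; rewrite mul0r.
by apply/val_inj; rewrite /lpilq_mul insubdK E//; exact: single_subproof.
Qed.

Lemma sum_singleE J (w : nat -> Rcomplex R) k :
  lpilq_val (\sum_(n <- J) single n (w n)) k = if k \in J then w k else 0.
Proof.
have -> : lpilq_val (\sum_(n <- J) single n (w n)) k =
    \sum_(n <- J) single_fun n (w n) k.
  exact: (big_morph (fun v : V => lpilq_val v k) (fun _ _ => erefl) erefl).
rewrite /single_fun; case: ifPn => [kJ|kJ].
  rewrite -big_mkcond/=; under eq_bigl do rewrite eq_sym.
  exact: (fbig_pred1_inj (k := id)).
rewrite big_seq big1// => n nJ; case: eqP => // kn.
by rewrite kn nJ in kJ.
Qed.

(** Once J contains an initial segment, the error of the sum over J is 0 on J and -z elsewhere, so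
    [lp_tail] bounds its real and imaginary parts whatever else J contains. *)
Lemma sum_single_unconditional (z : V) :
  unconditionally_converges (fun n => single n (z n)) z.
Proof.
move=> U /nbhs_ballP[e /= e0 eU].
(* Halving [e] turns the non-strict bound of [lp_tail] into membership in the open ball. *)
have e20 : 0 < e / 2 by rewrite divr_gt0.
have [N1 h1] := lp_tail p0 (lpilq_Re z) e20.
have [N2 h2] := lp_tail q0 (lpilq_Im z) e20.
exists [fset k in iota 0 (maxn N1 N2)]%fset => J /fsubsetP FJ.
set s := \sum_(n <- J) _.
have sE k : lpilq_val s k = if k \in J then z k else 0 by exact: sum_singleE.
have inJ k : (k < maxn N1 N2)%N -> k \in J.
  by move=> kN; apply: FJ; rewrite !inE mem_iota.
have dE k : lpilq_val (s - z) k = if k \in J then 0 else - z k.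
  rewrite -[LHS]/(lpilq_val s k - lpilq_val z k) sE.
  by case: ifP; rewrite ?subrr ?sub0r.
exists (s - z); last by rewrite addrC subrK.
apply: eU; rewrite -ball_normE/= sub0r normrN.
have e2e : e / 2 < e by rewrite ltr_pdivrMr// mulr_natr mulr2n ltrDl.
apply: le_lt_trans e2e.
have ReE k : Re (s - z) k = if k \in J then 0 else - Re z k.
  by rewrite [LHS](congr1 (@complex.Re R) (dE k)); case: ifP => //; rewrite raddfN.
have ImE k : Im (s - z) k = if k \in J then 0 else - Im z k.
  by rewrite [LHS](congr1 (@complex.Im R) (dE k)); case: ifP => //; rewrite raddfN.
apply/lpilq_norm_leP; split; [apply: h1|apply: h2] => k.
- by move=> kN; rewrite ReE inJ// leq_max kN.
- by rewrite ReE; case: ifP; rewrite ?normr0 ?normrN.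
- by move=> kN; rewrite ImE inJ// leq_max kN orbT.
- by rewrite ImE; case: ifP; rewrite ?normr0 ?normrN.
Qed.

(** Multiplication by i swaps the real and imaginary parts up to sign, so the conclusion says that i
    z lies in l_p (+) i l_q. *)
Lemma hirsch_mul_i (z : V) : hirsch (lpilq_mul p1 q1) ->
  Im z \in lp p /\ Re z \in lp q.
Proof.
move=> H; have U0 : nbhs (0 : V) (closed_ball_ Num.norm 0 1).
  by apply/nbhs_ballP; exists 1 => //= v; rewrite -ball_normE => /ltW.
have [W] := H _ (ex_intro _ z (sum_single_unconditional z)) _ U0.
move=> /nbhs_ballP[e /= e0 eW] hW.
pose d := e / 2; have d0 : 0 < d by rewrite divr_gt0.
(* [s n] is the truncation of d i z to its first n coordinates; the Hirsch property keeps all of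
   these in the closed unit ball. *)
pose s n : V := \sum_(k <- [fset k in iota 0 n]%fset) single k (Complex 0 d * z k).
have s_le1 n : `|s n| <= 1.
  have := hW [fset k in iota 0 n]%fset (fun k => single k (Complex 0 d)).
  rewrite /closed_ball_/= sub0r normrN; under eq_bigr do rewrite mul_single.
  apply => k _; apply: eW; rewrite -ball_normE/= sub0r normrN.
  have de : d < e by rewrite ltr_pdivrMr// mulr_natr mulr2n ltrDl.
  apply: le_lt_trans de.
  by apply: norm_single; rewrite /= ?normr0 ?(ltW d0)// gtr0_norm.
have sE n k : (k < n)%N -> lpilq_val (s n) k = Complex 0 d * z k.
  by move=> kn; rewrite sum_singleE !inE mem_iota /= kn.
(* Uniformly bounded truncations bound every partial sum of |d y k|^r by 1, which puts d y, hence y,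
   in l_r. *)
have bound r (y : R^nat) (u : nat -> R^nat) : 0 < r ->
    (forall n, u n \in lp r) -> (forall n, lp_norm r (u n) <= 1) ->
    (forall n k, (k < n)%N -> `|u n k| = `|d * y k|) -> y \in lp r.
  move=> r0 ur u1 uy.
  suff dy : d *: y \in lp r.
    by rewrite -[y](scalerK (lt0r_neq0 d0)); exact: (lpZ _ r0 dy).1.
  suff : d *: y \in lp r /\ lp_norm r (d *: y) <= 1 by case.
  apply/lp_norm_leP => // n; under eq_bigr => k _ do rewrite -(uy n k (ltn_ord k)).
  apply: le_trans (lp_normP n r0 (ur n)) _.
  by apply: ge0_ler_powR; rewrite ?nnegrE ?lp_norm_ge0 ?(ltW r0).
(* The real part of [s n] is -d Im z below n and its imaginary part is d Re z. *)
split.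
  apply: (bound _ _ (fun n => Re (s n))) => // [n|n|n k kn].
  - exact: lpilq_Re.
  - exact: le_trans (lpilq_norm_Re _) (s_le1 n).
  rewrite -[Re _ k]/(complex.Re (lpilq_val (s n) k)) sE//=.
  by case: (z k) => a b /=; rewrite mul0r sub0r normrN.
apply: (bound _ _ (fun n => Im (s n))) => // [n|n|n k kn].
- exact: lpilq_Im.
- exact: le_trans (lpilq_norm_Im _) (s_le1 n).
rewrite -[Im _ k]/(complex.Im (lpilq_val (s n) k)) sE//=.
by case: (z k) => a b /=; rewrite mul0r add0r.
Qed.

End lpilq_facts.

Theorem theorem7p10 (R : realType) (p q : R) (p1 : 1 <= p) (q1 : 1 <= q)
  (neq_pq : p != q) : ~ hirsch (lpilq_mul p1 q1).
Proof.
have p0 := lt_le_trans ltr01 p1; have q0 := lt_le_trans ltr01 q1.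
move=> h; have [pq|qp|pq] := ltgtP p q; last by rewrite pq eqxx in neq_pq.
- have [x [xq /negP]] := lp_not_sub p1 pq; apply.
  (* Here i x is in the ring, and multiplying it by i would put x in l_p. *)
  have zV : (fun k => Complex 0 (x k)) \in lpilq_pred p q.
    by apply/lpilq_predP; split => //; exact: (lp0 p0).1.
  exact: (hirsch_mul_i (Lpilq p1 q1 zV) h).1.
- have [x [xp /negP]] := lp_not_sub q1 qp; apply.
  (* Here the real sequence x is in the ring, and i x would put x in l_q. *)
  have zV : (fun k => Complex (x k) 0) \in lpilq_pred p q.
    by apply/lpilq_predP; split => //; exact: (lp0 q0).1.
  exact: (hirsch_mul_i (Lpilq p1 q1 zV) h).2.
Qed.
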